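(* Let $p\ge 1$ be an integer, let $c, v\in\mathbb{R}^p$ with $c^{T}v\le 0$, let $\lambda\in\mathbb{R}$ with $\lambda\le 0$, and let $j\ge 0$ be an integer. Define $h(t)=c^{T}v\,e^{\lambda t}t^{j}$ and $$\underline{h}(t)=c^{T}v\,t^{j}-\lambda\,c^{T}v\,t^{j+1}+\frac{\lambda^{2}}{2}\,c^{T}v\,t^{j+2}.$$ Then $\underline{h}(t)\le h(t)$ for all $t\ge 0$.
   Context: Here $v$ stands for either the state $x[t_k]\in\mathbb{R}^n$ or the control input $u[t_k]\in\mathbb{R}^m$ of a linear system $\dot x=Ax+Bu$ with zeroth-order-hold control, at the start of an update interval. The function $h$ is one term of the expansion of an affine predicate along the trajectory, where $\lambda$ is a real eigenvalue of $A$ and $j$ is the polynomial power coming from a Jordan block. Convention: $t^{0}=1$. *)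

(* Defs.v *)
From mathcomp Require Import all_boot all_order all_algebra.
From mathcomp Require Import all_reals all_analysis.
Set Implicit Arguments.
Unset Strict Implicit.
Unset Printing Implicit Defensive.
Import GRing.Theory Num.Theory.
Local Open Scope ring_scope.

(* c^T v: the unique entry of a 1 x 1 matrix product. *)
Definition inner (R : realType) (p : nat) (c v : 'cV[R]_p) : R :=
  (c^T *m v) 0 0.

(* The natural power satisfies t ^+ 0 = 1, including at t = 0. *)
Definition h (R : realType) (p : nat) (c v : 'cV[R]_p) (lambda : R) (j : nat)
    (t : R) : R :=
  inner c v * expR (lambda * t) * t ^+ j.

Definition h_lower (R : realType) (p : nat) (c v : 'cV[R]_p) (lambda : R)
    (j : nat) (t : R) : R :=
  inner c v * t ^+ j
  - lambda * inner c v * t ^+ j.+1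
  + lambda ^+ 2 / 2 * inner c v * t ^+ j.+2.

(* Main.v *)
Require Import Defs.
From mathcomp Require Import all_boot all_order all_algebra.
From mathcomp Require Import all_reals all_analysis.
From mathcomp Require Import ring lra.
Import GRing.Theory Num.Theory.
Local Open Scope ring_scope.

(** With [x = lambda * t <= 0], the bound is [c^T v * t ^+ j] times
    [1 - x + x ^+ 2 / 2], whose every term is nonnegative, so that it dominates
    [1 >= expR x]; multiplying by the nonpositive [c^T v] reverses the
    inequality. *)

Lemma expR_le_quadratic_npos (R : realType) (x : R) :
  x <= 0 -> expR x <= 1 - x + x ^+ 2 / 2.
Proof.
(* The quadratic is the Taylor polynomial of [expR (- x)], not of [expR x], so no remainder estimate
   enters: the constant 1 separates the two sides. *)
move=> x0; have ex1 : expR x <= 1 by rewrite -expR0 ler_expR.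
have := sqr_ge0 x; lra.
Qed.

Theorem mainTheorem3 (R : realType) (p : nat) (hp : (1 <= p)%N)
    (c v : 'cV[R]_p) (hcv : inner c v <= 0)
    (lambda : R) (hlambda : lambda <= 0) (j : nat) :
  forall t : R, 0 <= t -> h_lower c v lambda j t <= h c v lambda j t.
Proof.
move=> t t0.
(* Each extra power of [t] pairs with a power of [lambda], leaving a polynomial in [lambda * t];
   [exprS] exposes the common [t ^+ j] to [ring]. *)
have -> : h_lower c v lambda j t =
    inner c v * (1 - lambda * t + (lambda * t) ^+ 2 / 2) * t ^+ j.
  by rewrite /h_lower !exprS; ring.
apply: ler_wpM2r; first exact: exprn_ge0.
(* Cancelling [inner c v <= 0] flips the goal: the exponential must now lie below the quadratic. *)
apply: ler_wnM2l => //.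
by apply: expR_le_quadratic_npos; exact: mulr_le0_ge0.
Qed.
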